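(* Assume (A1)–(A4) and that for every $K\ge1$, $0<H(P^\star|\Pi_{K+1})<H(P^\star|\Pi_K)$. Then $P^\star\notin\Pi_\infty$ and, $P^\star$-a.s., $\liminf_{n\to\infty}\widehat K_n^L=\liminf_{n\to\infty}\widehat K_n^G=\infty$ (here $\widehat K_n^G$ is the smallest maximizer of $K\mapsto \mathrm{crit}(n,K)$ over all $K\ge1$).
   Context: Setting: $(\mathcal Z,\mathcal F)$ is a Polish space with its Borel $\sigma$-field and $\mu$ a $\sigma$-finite measure on it. $Z_1,Z_2,\dots$ are i.i.d. $\mathcal Z$-valued random variables with common law $P^\star\ll\mu$, density $p^\star$, $\ell^\star=\log p^\star$; $P^\star$ also denotes the law of the whole sequence. $\{(\Theta_K,d)\}_{K\ge1}$ is an increasing (nested) sequence of metric spaces, $\Theta_\infty=\bigcup_K\Theta_K$; for $\theta\in\Theta_\infty$, $P_\theta$ is a probability measure with density $p_\theta$ w.r.t. $\mu$ and $\ell_\theta=\log p_\theta$. $\Pi_K=\{P_\theta:\theta\in\Theta_K\}$, $\Pi_\infty=\bigcup_K\Pi_K$. $H(P|Q)=\int\log(dP/dQ)\,dP$ if $P\ll Q$ and $+\infty$ otherwise; $H(P|\Pi)=\inf_{Q\in\Pi}H(P|Q)$. Given a penalty $\mathrm{pen}(n,K)>0$, $\mathrm{crit}(n,K)=\sup_{\theta\in\Theta_K}\sum_{i=1}^n\ell_\theta(Z_i)-\mathrm{pen}(n,K)$, $\widehat K_n^L=\inf\{K\ge1:\mathrm{crit}(n,K)\ge\mathrm{crit}(n,K+1)\}$.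 All suprema are assumed measurable. Standing assumptions: (A1) each $(\Theta_K,d)$ is compact and each $\Pi_K$ is compact for the weak topology; (A2) for each $z$ and $K$, $\theta\mapsto\ell_\theta(z)$ is continuous on $\Theta_K$; (A3) there are $l,u:\mathcal Z\to\mathbb R$ with $u-l\in L^1(P^\star)$, $l\le\ell^\star\le u$ and $l\le\ell_\theta\le u$ for all $\theta\in\Theta_\infty$; (A4) for each $n$, $\mathrm{pen}(n,\cdot)$ is increasing, and for each $K$, $\mathrm{pen}(n,K)\to\infty$ and $\mathrm{pen}(n,K)=o(n)$ as $n\to\infty$. *)

(* Defs.v *)
From HB Require Import structures.
From mathcomp Require Import all_boot all_order all_algebra.
From mathcomp Require Import all_classical all_reals all_analysis.
Set Implicit Arguments. Unset Strict Implicit. Unset Printing Implicit Defensive.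
Import Order.TTheory GRing.Theory Num.Def Num.Theory.
Import numFieldNormedType.Exports.
Local Open Scope classical_set_scope.
Local Open Scope ring_scope.

Notation Borel T := (g_sigma_algebraType (@open T)).

(* Polish space: a complete metric space (the uniform structure of a complete
   pseudometric space which is Hausdorff, hence metric) which is separable. *)
Definition separable_space (T : topologicalType) :=
  exists2 D : set T, countable D & dense D.

Definition bcfun (R : realType) (T : topologicalType) :=
  {f : T -> R | continuous f /\ exists M : R, forall x, `|f x| <= M}.

(* Weak topology on probability measures: the initial topology of the map
   Q |-> (f |-> \int f dQ) into the product (pointwise) topology of R^{bcfun}.
   A set A of probabilities is weakly compact iff its image under this map is
   compact (opens of the initial topology are preimages of opens). *)

Section weak.
Context (R : realType) (Z : completePseudoMetricType R).

Definition weak_eval (Q : probability (Borel Z) R) : {ptws bcfun R Z -> R} :=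
  fun f => Rintegral Q setT (proj1_sig f).

Definition weakly_compact (A : set (probability (Borel Z) R)) : Prop :=
  compact (weak_eval @` A).
End weak.

Local Open Scope ereal_scope.
Local Open Scope charge_scope.

Definition relent d (T : measurableType d) (R : realType)
  (P Q : probability T R) : \bar R :=
  if `[< P `<< Q >] then
    \int[P]_x (ln (fine ('d (charge_of_finite_measure P) '/d Q x)))%:E
  else +oo.

Definition relent_set d (T : measurableType d) (R : realType) (Th : Type)
  (P : probability T R) (Pth : Th -> probability T R) (A : set Th) : \bar R :=
  ereal_inf [set relent P (Pth th) | th in A].

Definition iid_indep d dO (T : measurableType d) (Om : measurableType dO)
  (R : realType) (Pr : probability Om R) (X : nat -> Om -> T) : Prop :=
  forall (s : seq nat) (A : nat -> set T), uniq s ->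
    (forall i, i \in s -> measurable (A i)) ->
    Pr (\bigcap_(i in [set i | i \in s]) (X i @^-1` A i)) =
    \big[*%E/1%E]_(i <- s) Pr (X i @^-1` A i).

Section model_selection.
Context (R : realType) (Th Z Om : Type).
Variables (ell : Th -> Z -> R) (Theta : nat -> set Th) (pen : nat -> nat -> R)
  (X : nat -> Om -> Z).

(* crit(n,K) = sup_{theta in Theta_K} sum_{i=1}^n ell_theta(Z_i) - pen(n,K);
   the observations Z_1, ..., Z_n are X 0, ..., X (n-1). *)
Definition crit (n K : nat) (w : Om) : \bar R :=
  ereal_sup [set (\sum_(i < n) ell th (X i w))%:E | th in Theta K]%R
  - (pen n K)%:E.

(* Khat^L_n = inf {K >= 1 : crit(n,K) >= crit(n,K+1)}  (inf of empty = +oo) *)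
Definition KhatL (n : nat) (w : Om) : \bar R :=
  ereal_inf [set (K%:R)%:E | K in
    [set K : nat | (0 < K)%N /\ crit n K.+1 w <= crit n K w]].

(* Khat^G_n = smallest maximizer of K |-> crit(n,K) over K >= 1
   (+oo if the supremum is not attained) *)
Definition KhatG (n : nat) (w : Om) : \bar R :=
  ereal_inf [set (K%:R)%:E | K in
    [set K : nat | (0 < K)%N /\
       crit n K w = ereal_sup [set crit n K' w | K' in [set K' : nat | (0 < K')%N]]]].
End model_selection.

(* Main.v *)
Require Import Defs.
From HB Require Import structures.
From mathcomp Require Import all_boot all_order all_algebra.
From mathcomp Require Import all_classical all_reals all_analysis.
From mathcomp Require Import measurable_realfun lra.
Import Order.TTheory GRing.Theory Num.Def Num.Theory.
Import numFieldNormedType.Exports.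
Local Open Scope classical_set_scope.
Local Open Scope ring_scope.

Set Implicit Arguments. Unset Strict Implicit. Unset Printing Implicit Defensive.

(** Choose [th0] in [Theta K.+1] whose relative entropy is below
    [H(Pstar | Pi_K)].  The log-likelihood ratios [h th = ell th - ell th0],
    [th] in [Theta K], then have means at most [- 2 c < 0], and it is enough
    that almost surely [\sum_(i < n) h th (X i) <= C - c n] for all [n] and all
    [th] in [Theta K], since [pen n K.+1 = o(n)]: this gives
    [crit n K < crit n K.+1] for large [n].

    By compactness and domination (Wald's argument) the uniform bound reduces to
    a one-sided law of large numbers: i.i.d. integrable variables with negative
    mean have almost surely bounded above partial sums.  That law comes from the
    maximal ergodic inequality [0 <= \int_A f], where [A] is the event that the
    sums are unbounded above: [A] is shift invariant, hence independent of the
    first variable, so that [\int_A f] is the probability of [A] times the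
    negative mean, and [A] is negligible. *)

(** * Change of variables along a measurable map *)

Section image_measure.
Context d1 d2 (X : measurableType d1) (Y : measurableType d2) (R : realType).
Variables (phi : X -> Y) (mu : {measure set X -> \bar R}).
Variable nu : {measure set Y -> \bar R}.
Hypothesis mphi : measurable_fun [set: X] phi.
Hypothesis phiE : forall A, measurable A -> mu (phi @^-1` A) = nu A.

Lemma integrable_image (g : Y -> \bar R) :
  nu.-integrable [set: Y] g -> mu.-integrable [set: X] (g \o phi).
Proof.
move=> /integrableP[mg ig]; apply/integrableP; split.
  exact: (measurableT_comp mg mphi).
apply: le_lt_trans ig.
have mag : measurable_fun [set: Y] (fun y => `|g y|%E) by exact: measurableT_comp.
rewrite -(preimage_setT phi) -(@ge0_integral_pushforward _ _ _ _ _ _ mphi mu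
  setT (fun y => `|g y|%E))//.
by rewrite le_eqVlt; apply/orP; left; apply/eqP/eq_measure_integral => A mA _;
  exact: phiE.
Qed.

(** On measurable sets [nu] is the pushforward of [mu]. This serves both for the measure-preserving
    [tau] and for the first coordinate of a sequence. *)
Lemma integral_image (A : set Y) (g : Y -> \bar R) : measurable A ->
  nu.-integrable [set: Y] g ->
  (\int[mu]_(x in phi @^-1` A) g (phi x) = \int[nu]_(y in A) g y)%E.
Proof.
move=> mA ig.
rewrite -(integral_pushforward mphi (measurable_int _ ig) _ mA).
  by apply: eq_measure_integral => B mB _; exact: phiE.
apply: integrableS (integrable_image ig) => //.
by rewrite -[X in measurable X]setTI; exact: mphi.
Qed.
End image_measure.

(** * The maximal ergodic inequality *)

Section maximal_ergodic.
Context d (T : measurableType d) (R : realType) (Q : probability T R).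
Variables (tau : T -> T) (f : T -> R).
Hypothesis mtau : measurable_fun [set: T] tau.
Hypothesis tau_inv : forall A, measurable A -> Q (tau @^-1` A) = Q A.
Hypothesis intf : Q.-integrable [set: T] (EFin \o f).

(* maxsum n x = max_(k <= n) (f x + f (tau x) + ... + f (tau^(k-1) x)) *)
Fixpoint maxsum n (x : T) : R :=
  if n is m.+1 then Num.max 0 (f x + maxsum m (tau x)) else 0.

Lemma maxsum_ge0 n x : 0 <= maxsum n x.
Proof. by case: n => //= n; rewrite le_max lexx. Qed.

Lemma maxsum_leS n x : maxsum n x <= maxsum n.+1 x.
Proof.
elim: n x => [|n IH] x; first exact: maxsum_ge0.
by rewrite [leRHS]/= [leLHS]/= ge_max !le_max lexx lerD2l IH orbT.
Qed.

Lemma maxsum_nd x : {homo maxsum^~ x : n m / (n <= m)%N >-> n <= m}.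
Proof. by apply/nondecreasing_seqP => n; exact: maxsum_leS. Qed.

Lemma sum_le_maxsum n x : \sum_(i < n) f (iter i tau x) <= maxsum n x.
Proof.
elim: n x => [|n IH] x; first by rewrite big_ord0.
rewrite big_ord_recl/= le_max lerD2l; apply/orP; right.
by apply: le_trans (IH (tau x)); under eq_bigr do rewrite -iterS iterSr.
Qed.

Let mf : measurable_fun [set: T] f.
Proof. exact/measurable_EFinP/measurable_int/intf. Qed.

Lemma measurable_maxsum n : measurable_fun [set: T] (maxsum n).
Proof.
elim: n => [|n IH]; first exact: measurable_cst.
apply: measurable_maxr; first exact: measurable_cst.
by apply: measurable_funD => //; exact: measurableT_comp.
Qed.

Lemma integrable_maxsum n : Q.-integrable [set: T] (EFin \o maxsum n).
Proof.
elim: n => [|n IH]; first exact: integrable0.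
apply: le_integrable (integrableD measurableT intf (integrable_image mtau tau_inv IH)) => //.
  exact/measurable_EFinP/measurable_maxsum.
move=> x _ /=; rewrite lee_fin; case: (lerP 0 (f x + maxsum n (tau x))) => //.
by rewrite normr0.
Qed.

(** As [maxsum n x] is a running maximum, this is unboundedness above of the partial sums; natural
    thresholds [k] make it a countable combination of measurable sets. *)
Definition sums_unbounded : set T :=
  [set x | forall k : nat, exists n, k%:R < maxsum n x].

Lemma measurable_sums_unbounded : measurable sums_unbounded.
Proof.
have -> : sums_unbounded = \bigcap_k \bigcup_n [set x | k%:R < maxsum n x].
  apply/seteqP; split=> x xA k; first by move=> _; have [n] := xA k; exists n.
  by have [//|n _] := xA k; exists n.
apply: bigcap_measurable => // k _; apply: bigcup_measurable => n _.
rewrite -[X in measurable X]setTI.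
have -> : [set x | k%:R < maxsum n x] = maxsum n @^-1` `]k%:R, +oo[%classic.
  by apply/seteqP; split=> x /=; rewrite in_itv/= andbT.
exact: measurable_maxsum.
Qed.

(** The sums started at [x] and at [tau x] differ by the fixed number [f x], up to a shift of the
    index. *)
Lemma sums_unbounded_invariant : tau @^-1` sums_unbounded = sums_unbounded.
Proof.
apply/seteqP; split=> x xA k.
  have [n] := xA (Num.bound `|k%:R - f x|) => kn; exists n.+1 => /=.
  rewrite lt_max; apply/orP; right; rewrite -ltrBlDl; apply: lt_trans kn.
  by apply: le_lt_trans (ler_norm _) _; exact: archi_boundP (normr_ge0 _).
have [n] := xA (Num.bound `|k%:R + `|f x| |) => kn; exists n.
have : k%:R + `|f x| < maxsum n.+1 x.
  apply: lt_le_trans (maxsum_leS n x); apply: lt_trans kn.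
  by apply: le_lt_trans (ler_norm _) _; exact: archi_boundP (normr_ge0 _).
have := ler_norm (f x).
rewrite /= lt_max => ff /orP[|]; last lra.
by have := normr_ge0 (f x); have : 0 <= k%:R :> R by []; lra.
Qed.

(* On [A], max_(k <= n.+1) S_k - (max_(k <= n) S_k) o tau tends to [f], and its
   integral over [A] is nonnegative because [tau] preserves [Q] and [A]. *)
Lemma maximal_ergodic : (0 <= \int[Q]_(x in sums_unbounded) (f x)%:E)%E.
Proof.
have mA := measurable_sums_unbounded; set A := sums_unbounded in mA *.
have tauA : tau @^-1` A = A := sums_unbounded_invariant.
pose F n x := maxsum n.+1 x - maxsum n (tau x).
have FE n x : F n x = Num.max (- maxsum n (tau x)) (f x).
  by rewrite /F/= addr_maxl sub0r addrK.
have iM n : Q.-integrable A (EFin \o maxsum n).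
  exact: integrableS (integrable_maxsum n).
have iMt n : Q.-integrable A (EFin \o (maxsum n \o tau)).
  exact: integrableS (integrable_image mtau tau_inv (integrable_maxsum n)).
have F_ge0 n : (0 <= \int[Q]_(x in A) (F n x)%:E)%E.
  under eq_integral do rewrite EFinB.
  rewrite (integralB_EFin mA (iM n.+1) (iMt n)).
  have -> : (\int[Q]_(x in A) ((maxsum n \o tau) x)%:E =
            \int[Q]_(x in A) (maxsum n x)%:E)%E.
    by rewrite -{1}tauA; exact: (integral_image mtau tau_inv _ (integrable_maxsum n)).
  rewrite sube_ge0; last by apply/orP; left; exact: (integrable_fin_num mA (iM _)).
  by apply: (le_integral mA (iM n) (iM n.+1)) => x _; rewrite lee_fin maxsum_leS.
have [] := @dominated_convergence _ _ _ Q A mA (fun n x => (F n x)%:E)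
  (fun x => (f x)%:E) (fun x => `|f x|%:E).
- move=> n; apply/measurable_EFinP/measurable_funTS/measurable_funB.
    exact: measurable_maxsum.
  by apply: measurableT_comp mtau; exact: measurable_maxsum.
- exact/measurable_EFinP/measurable_funTS.
(* As [tau x] lies in [A] too, [maxsum n (tau x)] ends up above [|f x|], and the maximum in [FE] is
   then exactly [f x]. *)
- apply: aeW => x; rewrite -{1}tauA => Ax.
  apply: cvg_near_cst.
  have [n nf] := Ax (Num.bound `|f x|); exists n => //= m /= nm.
  rewrite FE; congr EFin; apply/max_idPr.
  have := maxsum_nd (tau x) nm.
  have := archi_boundP (normr_ge0 (f x)).
  by have := lerNnormlW (lexx `|f x|); lra.
- apply: integrableS (integrable_abse intf) => //.
(* [F n x] equals [f x] if that is nonnegative, and lies between [f x] and 0 otherwise. *)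
- apply: aeW => x n _; rewrite lee_fin FE.
  have := maxsum_ge0 n (tau x).
  case: (lerP 0 (f x)) => fx M0.
    by rewrite max_r ?ger0_norm//; lra.
  rewrite (ltr0_norm fx) ler_norml; apply/andP; split.
    by rewrite opprK le_max lexx orbT.
  by rewrite ge_max; apply/andP; split; lra.
by move=> _ _; apply: cvge_ge; apply: nearW => n /=.
Qed.

End maximal_ergodic.

(** * Sequence space, its cylinder sets and the shift *)

Definition cylinders d (T : measurableType d) : set (set (nat -> T)) :=
  [set C | exists A : nat -> set T, exists n, [/\ forall i, measurable (A i),
    forall i, (n <= i)%N -> A i = setT & C = [set x | forall i, A i (x i)]]].

Definition shift (T : Type) (x : nat -> T) : nat -> T := fun i => x i.+1.

Section sequence_space.
Context d (T : measurableType d).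
Local Notation S := (g_sigma_algebraType (@cylinders d T)).

Lemma measurable_cylinder (C : set S) : cylinders C -> measurable C.
Proof. by move=> cC; exact: sub_sigma_algebra. Qed.

(** Makes the cylinders a pi-system, on which [seq_law_shift_indep] compares two measures. *)
Lemma cylindersI : setI_closed (@cylinders d T).
Proof.
move=> _ _ [A [n [mA An ->]]] [B [m [mB Bm ->]]].
exists (fun i => A i `&` B i), (maxn n m); split.
- by move=> i; exact: measurableI.
- by move=> i; rewrite geq_max => /andP[ni mi]; rewrite An// Bm// setIT.
- apply/seteqP; split=> x; first by move=> [Ax Bx] i; split; [exact: Ax|exact: Bx].
  by move=> ABx; split=> i; have [] := ABx i.
Qed.

Lemma cylindersT : cylinders [set: S].
Proof. by exists (fun=> setT), 0%N; split=> //; apply/seteqP; split. Qed.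

Lemma measurable_to_seq d' (U : measurableType d') (X : nat -> U -> T) :
  (forall i, measurable_fun [set: U] (X i)) ->
  measurable_fun [set: U] ((fun w i => X i w) : U -> S).
Proof.
move=> mX; apply: (@measurability _ _ U S setT _ (@cylinders d T) erefl) => _ [_ [A [n [mA An ->]]] <-].
have -> : [set: U] `&` (fun w i => X i w) @^-1` [set x | forall i, A i (x i)] =
    \bigcap_i (X i @^-1` A i).
  by rewrite setTI; apply/seteqP; split=> [w Aw i _|w Aw i]; exact: Aw.
by apply: bigcap_measurable => // i _; rewrite -[X in measurable X]setTI; exact: mX.
Qed.

Lemma measurable_coord i : measurable_fun [set: S] ((fun x => x i) : S -> T).
Proof.
move=> _ B mB; rewrite setTI; apply: measurable_cylinder.
exists (fun j => if j == i then B else setT), i.+1; split.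
- by move=> j; case: ifP.
- by move=> j; case: eqP => // ->; rewrite ltnn.
- apply/seteqP; split=> x /=; first by move=> Bx j; case: eqP => // ->.
  by move=> /(_ i); rewrite eqxx.
Qed.

Lemma measurable_shift : measurable_fun [set: S] (@shift T : S -> S).
Proof.
by apply: (@measurable_to_seq _ S (fun i x => x i.+1)) => i; exact: measurable_coord.
Qed.

End sequence_space.

(** * Integration against a rescaled measure *)

Section integral_mscale.
Context d (T : measurableType d) (R : realType).
Variables (mu : {measure set T -> \bar R}) (k : {nonneg R}) (f : T -> \bar R).
Hypothesis intf : mu.-integrable [set: T] f.

Lemma integrable_mscale : (mscale k mu).-integrable [set: T] f.
Proof.
have /integrableP[mf ioo] := intf; apply/integrableP; split=> //.
by rewrite ge0_integral_mscale//; [exact: lte_mul_pinfty|exact: measurableT_comp].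
Qed.

Lemma integral_mscale :
  (\int[mscale k mu]_x f x = k%:num%:E * \int[mu]_x f x)%E.
Proof.
have mf := measurable_int _ intf.
rewrite [LHS]integralE (integralE mu) ge0_integral_mscale//; last first.
  exact: measurable_funepos.
rewrite ge0_integral_mscale//; last exact: measurable_funeneg.
apply/esym/muleBr => //; apply: fin_num_adde_defr.
by apply: integrable_pos_fin_num.
Qed.

End integral_mscale.

(** * A one-sided law of large numbers for i.i.d. sequences *)

Section iid_sequence.
Context d (T : measurableType d) (R : realType) (P0 : probability T R).
Context dO (Om : measurableType dO) (Pr : probability Om R).
Variable X : nat -> Om -> T.
Hypothesis mX : forall i, measurable_fun [set: Om] (X i).
Hypothesis indX : iid_indep Pr X.
Hypothesis lawX : forall i A, measurable A -> Pr (X i @^-1` A) = P0 A.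

Local Notation S := (g_sigma_algebraType (@cylinders d T)).

Let path : Om -> S := fun w i => X i w.
Let mpath : measurable_fun [set: Om] path. Proof. exact: measurable_to_seq. Qed.
Let path_mfun : {mfun Om >-> S} := HB.pack path (isMeasurableFun.Build _ _ _ _ path mpath).

(** [Om] carries no shift, so the argument moves to the law of the whole path on sequence space,
    where the shift acts. *)
Definition seq_law : probability S R := distribution Pr path_mfun.

Lemma seq_lawE (C : set S) : seq_law C = Pr [set w | C (fun i => X i w)].
Proof. by []. Qed.

Lemma seq_law_cylinder (A : nat -> set T) n : (forall i, measurable (A i)) ->
  (forall i, (n <= i)%N -> A i = setT) ->
  seq_law [set x | forall i, A i (x i)] = (\prod_(i <- iota 0 n) P0 (A i))%E.
Proof.
move=> mA An; rewrite -(eq_bigr _ (fun i _ => lawX i (mA i))).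
rewrite -indX ?iota_uniq// seq_lawE; congr (Pr _); apply/seteqP; split=> w Aw i.
  by move=> _; exact: Aw.
have [ni|ni] := leqP n i; first by rewrite An.
by apply: (Aw i) => /=; rewrite mem_iota add0n.
Qed.

(** With [B] fixed, both sides are finite measures in [C]; they agree on cylinders, hence
    everywhere. This yields at once that the first coordinate is independent of the later ones and
    that the shift preserves the law. *)
Lemma seq_law_shift_indep (B : set T) (C : set S) : measurable B -> measurable C ->
  seq_law ([set x | B (x 0%N)] `&` @shift T @^-1` C) = (P0 B * seq_law C)%E.
Proof.
move=> mB mC.
have mB0 : measurable [set x : S | B (x 0%N)].
  by rewrite -[X in measurable X]setTI; exact: measurable_coord.
have PBfin : P0 B \is a fin_num by rewrite fin_num_measure.
have PB0 : (0 <= fine (P0 B))%R by exact: fine_ge0.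
transitivity (mscale (NngNum PB0) seq_law C); last by rewrite /mscale/= fineK.
rewrite setIC -[LHS]/(pushforward (mrestr seq_law mB0) (@shift T : S -> S) C).
apply: (@measure_unique _ R S (@cylinders d T) (fun=> setT) erefl
  (@cylindersI d T) (fun=> @cylindersT d T) _
  (pushforward (mrestr seq_law mB0) (@shift T : S -> S))
  (mscale (NngNum PB0) seq_law)) => //.
- by rewrite bigcup_const//; exists 0%N.
- exact: measurable_shift.
- move=> _ _ [A [n [mA An ->]]] /=.
  rewrite /pushforward /mrestr /mscale/= fineK//.
  rewrite (seq_law_cylinder mA An).
  (* Putting [B] in front of the sides of the cylinder gives a cylinder again, of length [n.+1]. *)
  pose A' i := if i is j.+1 then A j else B.
  transitivity (seq_law [set x | forall i, A' i (x i)]).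
    congr (seq_law _); apply/seteqP; split=> x.
      by move=> [Ax Bx] [|i] //=; exact: Ax.
    by move=> Ax; split; [move=> i; exact: (Ax i.+1)|exact: (Ax 0%N)].
  rewrite (@seq_law_cylinder A' n.+1).
  + by rewrite /= big_cons -[1%N]/(1 + 0)%N iotaDl big_map.
  + by case.
  + by case=> // i; exact: An.
- by move=> _ _ /=; rewrite /pushforward /mrestr preimage_setT setTI ltey_eq fin_num_measure.
Qed.

Lemma seq_law_shift (C : set S) : measurable C ->
  seq_law (@shift T @^-1` C) = seq_law C.
Proof.
move=> mC; have := seq_law_shift_indep measurableT mC.
by rewrite probability_setT mul1e => <-; congr (seq_law _); rewrite setTI.
Qed.

Lemma seq_law_coord0 (B : set T) : measurable B ->
  seq_law [set x | B (x 0%N)] = P0 B.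
Proof. by move=> mB; rewrite seq_lawE; exact: lawX. Qed.

Variable f : T -> R.
Hypothesis intf : P0.-integrable [set: T] (EFin \o f).

Let g : S -> R := fun x => f (x 0%N).

Let mcoord0 : measurable_fun [set: S] ((fun x => x 0%N) : S -> T).
Proof. exact: measurable_coord. Qed.

Let intg : seq_law.-integrable [set: S] (EFin \o g).
Proof. exact: (integrable_image mcoord0 seq_law_coord0 intf). Qed.

(** A shift-invariant [A] is independent of the first coordinate: restricting the law to [A] and
    projecting to that coordinate yields [P0] scaled by the probability of [A]. *)
Lemma integral_shift_invariant (A : set S) : measurable A ->
  @shift T @^-1` A = A ->
  (\int[seq_law]_(x in A) (f (x 0%N))%:E = seq_law A * \int[P0]_z (f z)%:E)%E.
Proof.
move=> mA invA.
have QAfin : seq_law A \is a fin_num by rewrite fin_num_measure.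
have QA0 : (0 <= fine (seq_law A))%R by exact: fine_ge0.
pose Q := mrestr seq_law mA; pose M := mscale (NngNum QA0) P0.
have QM (B : set T) : measurable B -> Q ((fun x : S => x 0%N) @^-1` B) = M B.
  move=> mB; rewrite /Q /mrestr /M /mscale/= fineK// muleC.
  by rewrite -(seq_law_shift_indep mB mA) invA.
have intM : M.-integrable [set: T] (EFin \o f) by exact: integrable_mscale.
rewrite -[in RHS](fineK QAfin) -(integral_mscale (NngNum QA0) intf).
rewrite -[RHS](integral_image mcoord0 QM measurableT intM) preimage_setT.
have intQ := integrable_image mcoord0 QM intM.
(* The restricted measure does not charge the complement of [A], so integrating over the whole space
   or over [A] is the same. *)
rewrite [RHS](negligible_integral (measurableC mA) _ intQ)//.
- rewrite setTD setCK; apply: eq_measure_integral => B mB BA.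
  by rewrite /Q /= /mrestr setIidl.
- by rewrite /Q/= /mrestr setICl measure0.
Qed.

Lemma iid_sums_bounded : (\int[P0]_z (f z)%:E < 0)%E ->
  {ae Pr, forall w, exists C : R, forall n, \sum_(i < n) f (X i w) <= C}.
Proof.
move=> f_lt0; pose A := @sums_unbounded _ S R (@shift T) g.
have mA : measurable A.
  exact: (measurable_sums_unbounded (@measurable_shift d T) intg).
have A0 : seq_law A = 0%E.
  have := maximal_ergodic (@measurable_shift d T) seq_law_shift intg.
  rewrite -/A integral_shift_invariant//; last first.
    exact: (sums_unbounded_invariant (@shift T : S -> S) g).
  have : (0 <= seq_law A)%E by [].
  (* A positive probability times the negative mean would contradict the maximal ergodic
     inequality. *)
  rewrite le_eqVlt => /orP[/eqP <-//|A_gt0].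
  by rewrite leNgt mule_gt0_lt0// .
exists (path @^-1` A); split.
- by rewrite -[X in measurable X]setTI; exact: mpath.
- exact: A0.
- move=> w /= nb k; apply: contrapT => /forallNP kP; apply: nb.
  exists k%:R => n; rewrite leNgt; apply/negP => kn; apply: (kP n).
  apply: lt_le_trans kn _; apply: le_trans (sum_le_maxsum (@shift T : S -> S) g n _).
  rewrite le_eqVlt; apply/orP; left; apply/eqP/eq_bigr => i _.
  (* Coordinate 0 of the path shifted [i] times is [X i]; the induction needs a general coordinate
     [j]. *)
  rewrite /g; congr f; have : forall j, iter i (@shift T) (path w) j = X (i + j)%N w.
    by elim: (i : nat) => //= k' IH j; rewrite /shift IH addnS addSn.
  by move=> ->; rewrite addn0.
Qed.

End iid_sequence.

(** The boundedness result is applied to [f + c], whose mean is still negative. *)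
Lemma iid_sums_drift d (T : measurableType d) (R : realType) (P0 : probability T R)
    dO (Om : measurableType dO) (Pr : probability Om R) (X : nat -> Om -> T)
    (f : T -> R) (c : R) :
  (forall i, measurable_fun [set: Om] (X i)) -> iid_indep Pr X ->
  (forall i A, measurable A -> Pr (X i @^-1` A) = P0 A) ->
  P0.-integrable [set: T] (EFin \o f) -> (\int[P0]_z (f z)%:E < (- c)%:E)%E ->
  {ae Pr, forall w, exists C : R, forall n,
    \sum_(i < n) f (X i w) <= C - c * n%:R}.
Proof.
move=> mX indX lawX intf fc.
have intc : P0.-integrable [set: T] (EFin \o (fun=> c)).
  exact: finite_measure_integrable_cst.
have intfc : P0.-integrable [set: T] (EFin \o (fun z => f z + c)).
  by apply: eq_integrable (integrableD measurableT intf intc).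
have : (\int[P0]_z (f z + c)%:E < 0)%E.
  under eq_integral do rewrite EFinD.
  rewrite (integralD_EFin measurableT intf intc) integral_cst//= probability_setT mule1.
  by rewrite -lteBrDr// sub0e -EFinN.
move=> /(iid_sums_bounded mX indX lawX intfc); apply: filterS => w [C CP].
exists C => n; rewrite lerBrDr; apply: le_trans (CP n).
by rewrite big_split/= sumr_const card_ord mulr_natr.
Qed.

(** * Finite nets and countable dense subsets of compact sets *)

Lemma compact_finite_net (R : realType) (M : pseudoMetricType R) (K : set M)
    (e : R) : compact K -> 0 < e ->
  exists s : set M, [/\ finite_set s, s `<=` K &
    forall x, K x -> exists2 y, s y & ball y e x].
Proof.
move=> /compact_near_coveringP/near_covering_withinP cK e0.
(* [F] is the filter of properties shared by all supersets of some finite subset of [K]; near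
   covering along it produces one finite net for all of [K]. *)
pose F : set_system (set M) := [set S | exists s0 : set M,
  [/\ finite_set s0, s0 `<=` K & forall s, s0 `<=` s -> S s]].
have FF : Filter F.
  split.
  - by exists set0; split.
  - move=> P Q [s [fs sK sP]] [t [ft tK tQ]]; exists (s `|` t); split.
    + by rewrite finite_setU.
    + by move=> x [/sK|/tK].
    + move=> r str; split; [apply: sP|apply: tQ] => x xs; apply: str; [left|right];
        exact: xs.
  - by move=> P Q PQ [s [fs sK sP]]; exists s; split=> // r /sP /PQ.
have [x Kx|s [fs sK sP]] := cK _ F (fun s x => exists2 y, s y & ball y e x) FF.
  exists (ball x e, [set s | s x]) => /=.
    split; first exact: nbhsx_ballx.
    exists [set x]; split; [exact: finite_set1|by move=> _ ->|].
    by move=> s; apply.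
  by move=> [y s]/= [yx sx] Ky; exists x.
by exists s; split=> // x Kx; apply: (sP s).
Qed.

(** The union of finite [1/(n+1)]-nets. It lets suprema over parameters be taken over countable
    sets, hence be measurable. *)
Lemma compact_countable_dense (R : realType) (M : pseudoMetricType R)
    (K : set M) : compact K ->
  exists D : set M, [/\ countable D, D `<=` K &
    forall x U, K x -> nbhs x U -> exists2 y, D y & U y].
Proof.
move=> cK.
have /choice[s sP] : forall n : nat, exists s : set M, [/\ finite_set s, s `<=` K &
    forall x, K x -> exists2 y, s y & ball y n.+1%:R^-1 x].
  by move=> n; apply: compact_finite_net => //; rewrite invr_gt0.
exists (\bigcup_n s n); split.
- by apply: bigcup_countable => // n _; have [/finite_set_countable] := sP n.
- by move=> x [n _]; have [_ + _] := sP n; apply.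
- move=> x U Kx /nbhs_ballP[e /= e0 eU].
  have [n ne] : exists n : nat, n.+1%:R^-1 < e.
    by have [n _ nP] := near_infty_natSinv_lt (PosNum e0); exists n; apply: (nP n) => /=.
  have [_ _ /(_ _ Kx)[y sy yx]] := sP n.
  exists y; first by exists n.
  by apply: eU; apply: ball_sym; apply: le_ball yx; exact: ltW.
Qed.

(** * Wald's argument: a uniform upper bound over a compact parameter set *)

Section wald.
Context d (T : measurableType d) (R : realType) (P0 : probability T R).
Context (Th : pseudoMetricType R) (K : set Th) (h : Th -> T -> R) (G : T -> R).
Hypothesis cK : compact K.
Hypothesis mh : forall th, K th -> measurable_fun [set: T] (h th).
Hypothesis hG : forall th z, K th -> `|h th z| <= G z.
Hypothesis intG : P0.-integrable [set: T] (EFin \o G).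
Hypothesis ch : forall z, {within K, continuous (fun th => h th z)}.

(** [Y] is a supremum of [h] over a countable dense set of parameters near [th]. As the
    neighbourhood shrinks it tends to [h th] by continuity, and domination by [G] carries the strict
    inequality of means over to one such neighbourhood. *)
Lemma wald_local (c : R) th : K th -> (\int[P0]_z (h th z)%:E < (- c)%:E)%E ->
  exists U Y, [/\ nbhs th U, P0.-integrable [set: T] (EFin \o Y),
    (\int[P0]_z (Y z)%:E < (- c)%:E)%E &
    forall th' z, K th' -> U th' -> h th' z <= Y z].
Proof.
move=> Kth hc; have [D [cD DK dD]] := compact_countable_dense cK.
(* The interior makes [V n] a neighbourhood of each of its points, as the density argument at the
   end requires. *)
pose V n : set Th := (ball th n.+1%:R^-1)°.
have Vth n : nbhs th (V n).
  by apply: nbhs_interior; apply: nbhsx_ballx; rewrite invr_gt0.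
have /choice[e eE] : forall n, exists e : nat -> Th, range e = D `&` V n.
  move=> n; have cDV : countable (D `&` V n).
    by apply: sub_countable cD; apply: subset_card_le; exact: subIsetl.
  have [/seteqP[DV0 _]|[e]] := pfcard_geP cDV.
    by have [y Dy Vy] := dD _ _ Kth (Vth n); have [] := DV0 y.
  by exists e; rewrite image_eq.
have eP n k : D (e n k) /\ V n (e n k) by rewrite -[_ /\ _]/((D `&` V n) _) -eE; exists k.
have Ke n k : K (e n k) by apply: DK; have [] := eP n k.
pose Y n z := sups (fun k => h (e n k) z) 0.
have hub n z : has_ubound (range (fun k => h (e n k) z)).
  by exists (G z) => _ [k _ <-]; apply: le_trans (ler_norm _) (hG _ (Ke n k)).
have YE n z : Y n z = sup (range (fun k => h (e n k) z)).
  by rewrite /Y /sups /sdrop/=; congr (sup _); apply/seteqP; split=> _ [k _ <-]; exists k.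
have leY n k z : h (e n k) z <= Y n z.
  by rewrite YE; apply: ub_le_sup => //; exists k.
have Yle n z a : (forall k, h (e n k) z <= a) -> Y n z <= a.
  move=> ha; rewrite YE; apply: ge_sup; first by exists (h (e n 0%N) z), 0%N.
  by move=> _ [k _ <-].
have mY n : measurable_fun [set: T] (Y n).
  by apply: measurable_fun_sups => [z _|k]; [exact: hub|exact: mh].
have YG n z : `|Y n z| <= G z.
  rewrite ler_norml; apply/andP; split.
    apply: le_trans (leY n 0%N z); have := hG z (Ke n 0%N).
    by rewrite ler_norml => /andP[].
  by apply: Yle => k; apply: le_trans (ler_norm _) (hG _ (Ke n k)).
have intY n : P0.-integrable [set: T] (EFin \o Y n).
  apply: le_integrable intG => //; first exact/measurable_EFinP.
  by move=> z _; rewrite lee_fin; apply: le_trans (YG n z) (ler_norm _).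
have Yh z : Y n z @[n --> \oo] --> h th z.
  apply/cvgrPdist_le => eps eps0.
  have /subspace_continuousP/(_ _ Kth)/cvgrPdist_le/(_ _ eps0) := @ch z.
  move=> /nbhs_ballP[r /= r0 rP]; near=> n.
  have eb k : `|h th z - h (e n k) z| <= eps.
    apply: rP => //; have [_ /interior_subset] := eP n k; apply: le_ball.
    by apply: ltW; near: n; exact: (near_infty_natSinv_lt (PosNum r0)).
  rewrite ler_norml; apply/andP; split.
    rewrite lerBrDr addrC lerBlDr; apply: Yle => k; have := eb k.
    by rewrite ler_norml => /andP[]; lra.
  have := leY n 0%N z; have := eb 0%N; rewrite ler_norml => /andP[]; lra.
have [] := @dominated_convergence _ _ _ P0 setT measurableT (fun n z => (Y n z)%:E)
  (fun z => (h th z)%:E) (EFin \o G).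
- by move=> n; exact/measurable_EFinP.
- exact/measurable_EFinP/mh.
- by apply: aeW => z _; apply: cvg_EFin; [exact: nearW|exact: Yh].
- exact: intG.
- by apply: aeW => z n _; rewrite lee_fin.
move=> _ _ cvgY.
have [n Yc] : exists n, (\int[P0]_z (Y n z)%:E < (- c)%:E)%E.
  apply: contrapT => /forallNP nY; move: hc; apply/negP; rewrite -leNgt.
  apply: cvge_ge cvgY; apply: nearW => n /=; rewrite leNgt; apply/negP; exact: nY.
exists (V n), (Y n); split=> // th' z Kth' Vth'.
(* Points of the dense set approximate [th'] inside [V n], so by continuity the bound passes from
   them to [th']. *)
apply/ler_addgt0Pr => eps eps0.
have /subspace_continuousP/(_ _ Kth')/cvgrPdist_le/(_ _ eps0) := @ch z.
move=> nb; have nK : nbhs th' [set t | K t -> `|h th' z - h t z| <= eps] by exact: nb.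
have nV : nbhs th' (V n) by exact: nbhs_interior.
have [y Dy [+ Vy]] := dD _ _ Kth' (filterI nK nV).
move=> /(_ (DK _ Dy)) yeps.
have [k _ ky] : range (e n) y by rewrite eE.
have := leY n k z; rewrite ky; move: yeps; rewrite ler_norml => /andP[]; lra.
Unshelve. all: by end_near. Qed.

Context dO (Om : measurableType dO) (Pr : probability Om R).
Variable X : nat -> Om -> T.
Hypothesis mX : forall i, measurable_fun [set: Om] (X i).
Hypothesis indX : iid_indep Pr X.
Hypothesis lawX : forall i A, measurable A -> Pr (X i @^-1` A) = P0 A.

(* Compactness is used in its filter form, on the filter of the sets of pairs
   (w, k) that hold for almost all w and all large k; this makes the constant
   uniform in th. *)
Lemma wald (c : R) :
  (forall th, K th -> (\int[P0]_z (h th z)%:E < (- c)%:E)%E) ->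
  {ae Pr, forall w, exists C : R, forall n th, K th ->
    \sum_(i < n) h th (X i w) <= C - c * n%:R}.
Proof.
move=> hc; have /compact_near_coveringP/near_covering_withinP ncK := cK.
pose F : set_system (Om * nat) :=
  [set A | {ae Pr, forall w, \forall k \near \oo, A (w, k)}].
have FF : Filter F.
  split.
  - by apply: aeW => w; exact: nearW.
  - move=> A B; rewrite /F/=; apply: filterS2 => w; exact: filterI.
  - by move=> A B AB; rewrite /F/=; apply: filterS => w; apply: filterS => k; exact: AB.
have : F [set wk | K `<=` [set th | forall n,
    \sum_(i < n) h th (X i wk.1) <= wk.2%:R - c * n%:R]].
  apply: (ncK _ F (fun wk th => forall n,
    \sum_(i < n) h th (X i wk.1) <= wk.2%:R - c * n%:R) FF) => th Kth.
  have [U [Y [nU intY Yc hY]]] := wald_local Kth (hc _ Kth).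
  (* [U] does not depend on [w]; the constant [C] of the drift bound does, and is absorbed by large
     [k]. *)
  exists (U, [set wk | forall n, \sum_(i < n) Y (X i wk.1) <= wk.2%:R - c * n%:R]).
    split=> //=; have := iid_sums_drift mX indX lawX intY Yc.
    apply: filterS => w [C CP]; near=> k => n /=; apply: le_trans (CP n) _.
    by rewrite lerD2r; near: k; exact: nbhs_infty_ger.
  move=> [th' wk]/= [Uth' wkP] Kth' n; apply: le_trans (wkP n).
  by apply: ler_sum => i _; exact: hY.
rewrite /F/=; apply: filterS => w [k _ kP]; exists k%:R => n th Kth.
exact: (kP k (leqnn k) th Kth n).
Unshelve. all: by end_near. Qed.
End wald.

Local Open Scope charge_scope.

(** * Relative entropy as the mean of a log-density ratio *)

Section densities.
Context d (T : measurableType d) (R : realType).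
Variable mu : {sigma_finite_measure set T -> \bar R}.

(** Strict positivity gives [P] and [mu] the same null sets, so that between two such laws the [+oo]
    branch of [relent] never occurs. *)
Definition has_pos_density (P : probability T R) (p : T -> R) :=
  [/\ forall z, 0 < p z, measurable_fun [set: T] p &
    forall A, measurable A -> P A = (\int[mu]_(x in A) (p x)%:E)%E].

Variables (P : probability T R) (p : T -> R).
Hypothesis dP : has_pos_density P p.

Lemma density_dominated : P `<< mu.
Proof.
have [p0 mp pE] := dP.
apply/null_content_dominatesP => A mA A0; rewrite pE//.
by rewrite null_set_integral//; exact/measurable_EFinP/measurable_funTS.
Qed.

Lemma pos_density_dominates : mu `<< P.
Proof.
have [p0 mp pE] := dP.
apply/null_content_dominatesP => A mA PA0.
have A0 : (\int[mu]_(x in A) (p x)%:E = 0)%E by rewrite -pE.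
have mpA : measurable_fun A (EFin \o p) by exact/measurable_EFinP/measurable_funTS.
have : (\int[mu]_(x in A) `|(EFin \o p) x| = 0)%E.
  by rewrite -[RHS]A0; apply: eq_integral => x _ /=; rewrite gtr0_norm.
move/(ae_eq_integral_abs mu mA mpA) => [N [mN N0 AN]].
apply/eqP; rewrite -measure_le0 -N0; apply: le_measure; rewrite ?inE// => x Ax.
apply: AN => /= /(_ Ax) [px0]; have := p0 x; by rewrite px0 ltxx.
Qed.

Lemma density_Radon_Nikodym :
  ae_eq mu setT ('d (charge_of_finite_measure P) '/d mu) (EFin \o p).
Proof.
have [p0 mp pE] := dP; have Pmu := density_dominated.
apply: integral_ae_eq => //.
- exact: Radon_Nikodym_integrable.
- exact/measurable_EFinP.
- by move=> E _ mE; rewrite -Radon_Nikodym_integral//= pE.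
Qed.

End densities.

(** The chain rule for Radon-Nikodym derivatives identifies the derivative of [P] in [Q] with
    [p / q], [mu]-almost everywhere and hence [P]-almost everywhere. *)
Lemma relent_density d (T : measurableType d) (R : realType)
    (mu : {sigma_finite_measure set T -> \bar R}) (P Q : probability T R)
    (p q : T -> R) : has_pos_density mu P p -> has_pos_density mu Q q ->
  relent P Q = (\int[P]_x (ln (p x) - ln (q x))%:E)%E.
Proof.
move=> dP dQ.
have [p0 mp pE] := dP; have [q0 mq qE] := dQ.
have Pmu := density_dominated dP; have Qmu := density_dominated dQ.
have PQ : P `<< Q := null_dominates_trans Pmu (pos_density_dominates dQ).
rewrite /relent; case: asboolP => // _.
apply: ae_eq_integral => //.
- apply/measurable_EFinP; apply: measurableT_comp; first exact: measurable_ln.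
  apply: measurableT_comp; first exact: fine_measurable.
  apply: (measurable_int Q).
  exact: (@Radon_Nikodym_integrable _ _ _ (charge_of_finite_measure P) Q PQ).
- apply/measurable_EFinP/measurable_funB; apply: measurableT_comp => //;
    exact: measurable_ln.
apply: (null_dominates_ae_eq _ Pmu) => //.
have := @Radon_Nikodym_chain_rule _ _ _ (charge_of_finite_measure P) mu Q PQ Qmu.
have := density_Radon_Nikodym dP; have := density_Radon_Nikodym dQ.
apply: filterS3 => x /= /(_ Logic.I) qx /(_ Logic.I) px /(_ Logic.I) + _.
rewrite px qx.
have := @Radon_Nikodym_fin_num _ _ _ (charge_of_finite_measure P) Q x PQ.
move=> /fineK <-; rewrite -EFinM => -[pxE] /=.
(* [p x] and [q x] are positive, hence so is the derivative of [P] in [Q] at [x], and the logarithm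
   splits. *)
rewrite pxE lnM//; first by rewrite addrK.
  by rewrite posrE -(pmulr_lgt0 _ (q0 x)) -pxE.
by rewrite posrE.
Qed.

(** * From strict increase of the criterion to divergence of the estimators *)

Section order_estimators.
Context (R : realType) (Th Z Om : Type).
Variables (ell : Th -> Z -> R) (Theta : nat -> set Th) (pen : nat -> nat -> R)
  (X : nat -> Om -> Z).

(** Dropping the penalty bounds the left side by [b], while the single parameter [th0] bounds the
    right side from below. *)
Lemma crit_ltS n K w th0 (b : R) : Theta K.+1 th0 ->
  (forall th, Theta K th -> \sum_(i < n) ell th (X i w) <= b) ->
  0 <= pen n K -> b + pen n K.+1 < \sum_(i < n) ell th0 (X i w) ->
  (crit ell Theta pen X n K w < crit ell Theta pen X n K.+1 w)%E.
Proof.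
move=> Th0 leb pen0 bpen; rewrite /crit.
apply: (@le_lt_trans _ _ b%:E).
  apply: (@le_trans _ _ (b%:E - (pen n K)%:E)%E).
    apply: leeB => //; apply: ge_ereal_sup => _ [th Kth <-].
    by rewrite lee_fin leb.
  by rewrite -EFinB lee_fin gerBl.
apply: (@lt_le_trans _ _ ((\sum_(i < n) ell th0 (X i w)) - pen n K.+1)%:E).
  by rewrite lte_fin ltrBrDr.
by rewrite EFinB; apply: leeB => //; apply: ereal_sup_ubound; exists th0.
Qed.

(** For each [A], eventually [crit] increases strictly at every positive [K < A], so neither
    estimator can be below [A]: a maximizer, too, is an index without strict increase. *)
Lemma limn_einf_Khat w :
  (forall K, (0 < K)%N -> \forall n \near \oo,
    (crit ell Theta pen X n K w < crit ell Theta pen X n K.+1 w)%E) ->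
  limn_einf (fun n => KhatL ell Theta pen X n w) = +oo%E /\
  limn_einf (fun n => KhatG ell Theta pen X n w) = +oo%E.
Proof.
move=> critS.
have crit_all (A : nat) : \forall n \near \oo, forall K, (0 < K)%N -> (K < A)%N ->
    (crit ell Theta pen X n K w < crit ell Theta pen X n K.+1 w)%E.
  elim: A => [|A IH]; first exact: nearW.
  have [->|A0] := posnP A; first by apply: nearW => n [].
  have := critS _ A0; apply: filterS2 IH => n IH nA K K0.
  by rewrite ltnS leq_eqVlt => /orP[/eqP ->|]; [exact: nA|exact: IH].
(* [S n] stands for the candidate set of either estimator; if it is empty, its infimum is [+oo],
   which fits. *)
have inf_ge (S : nat -> set nat) :
    (forall n K, S n K -> (0 < K)%N /\
       ~ (crit ell Theta pen X n K w < crit ell Theta pen X n K.+1 w)%E) ->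
    limn_einf (fun n => ereal_inf [set (K%:R : R)%:E | K in S n]) = +oo%E.
  move=> SP; apply: (cvg_limn_einf_sup _).1; apply/cvgeyPge => a.
  have := crit_all (Num.bound `|a|); apply: filterS => n nP.
  apply: le_ereal_inf_tmp => _ [K SK <-]; have [K0 nlt] := SP _ _ SK.
  rewrite lee_fin; have [aK|Ka] := leqP (Num.bound `|a|) K; last first.
    by case: nlt; exact: nP.
  apply: le_trans (ler_norm _) _; apply: le_trans (ltW (archi_boundP (normr_ge0 _))) _.
  by rewrite ler_nat.
split; apply: inf_ge => n K [K0 cK]; split=> //; apply/negP; rewrite -leNgt //.
by rewrite cK; apply: ereal_sup_ubound; exists K.+1.
Qed.

End order_estimators.

(** * Conclusion for the model selection problem *)

Unset Implicit Arguments. Set Strict Implicit.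

Theorem theorem5
  (R : realType)
  (* Polish sample space Z with its Borel sigma-field *)
  (Z : completePseudoMetricType R)
  (Z_hausdorff : hausdorff_space Z)
  (Z_separable : separable_space Z)
  (mu : {sigma_finite_measure set (Borel Z) -> \bar R})
  (* the true law P* with density p* w.r.t. mu *)
  (Pstar : probability (Borel Z) R) (pstar : Z -> R)
  (pstar_ge0 : forall z, 0 <= pstar z)
  (pstar_meas : measurable_fun [set: Borel Z] (pstar : Borel Z -> R))
  (pstar_dens : forall A : set (Borel Z), measurable A ->
      Pstar A = (\int[mu]_(x in A) (pstar x)%:E)%E)
  (* nested parameter spaces Theta_K (K >= 1) in a common metric space *)
  (Th : metricType R) (Theta : nat -> set Th)
  (Theta_nested : forall K, (0 < K)%N -> Theta K `<=` Theta K.+1)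
  (* the models P_theta, with density p_theta w.r.t. mu *)
  (P : Th -> probability (Borel Z) R) (p : Th -> Z -> R)
  (p_ge0 : forall th, (exists2 K, (0 < K)%N & Theta K th) -> forall z, 0 <= p th z)
  (p_meas : forall th, (exists2 K, (0 < K)%N & Theta K th) ->
      measurable_fun [set: Borel Z] (p th : Borel Z -> R))
  (p_dens : forall th, (exists2 K, (0 < K)%N & Theta K th) ->
      forall A : set (Borel Z), measurable A ->
      P th A = (\int[mu]_(x in A) (p th x)%:E)%E)
  (* the i.i.d. sample Z_1, Z_2, ... (X 0, X 1, ...) with law P* *)
  (dO : measure_display) (Om : measurableType dO) (Pr : probability Om R)
  (X : nat -> Om -> Borel Z)
  (X_meas : forall i, measurable_fun [set: Om] (X i))
  (X_indep : iid_indep Pr X)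
  (X_law : forall i (A : set (Borel Z)), measurable A -> Pr (X i @^-1` A) = Pstar A)
  (* penalty *)
  (pen : nat -> nat -> R)
  (* (A1) *)
  (A1_Theta : forall K, (0 < K)%N -> compact (Theta K))
  (A1_Pi : forall K, (0 < K)%N -> weakly_compact (P @` Theta K))
  (* (A2) *)
  (A2 : forall (z : Z) K, (0 < K)%N ->
      {within Theta K, continuous (fun th => ln (p th z))})
  (* (A3) *)
  (l u : Z -> R)
  (A3_int : Pstar.-integrable [set: Borel Z] (fun z => (u z - l z)%:E))
  (A3_star : forall z, 0 < pstar z /\ l z <= ln (pstar z) <= u z)
  (A3_th : forall th, (exists2 K, (0 < K)%N & Theta K th) ->
      forall z, 0 < p th z /\ l z <= ln (p th z) <= u z)
  (* (A4) *)
  (pen_gt0 : forall n K, (0 < n)%N -> (0 < K)%N -> 0 < pen n K)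
  (pen_incr : forall n K K', (0 < K)%N -> (K <= K')%N -> pen n K <= pen n K')
  (pen_infty : forall K, (0 < K)%N -> (fun n => pen n K) @ \oo --> +oo)
  (pen_on : forall K, (0 < K)%N -> (fun n => pen n K / n%:R) @ \oo --> 0)
  (* strict decrease of the approximation errors *)
  (H_gap : forall K, (0 < K)%N ->
      (0 < relent_set Pstar P (Theta K.+1))%E /\
      (relent_set Pstar P (Theta K.+1) < relent_set Pstar P (Theta K))%E) :
  ~ (exists2 th, (exists2 K, (0 < K)%N & Theta K th) &
       forall A : set (Borel Z), measurable A -> P th A = Pstar A) /\
  {ae Pr, forall w,
     limn_einf (fun n => KhatL (fun th z => ln (p th z)) Theta pen X n w) = +oo%E /\
     limn_einf (fun n => KhatG (fun th z => ln (p th z)) Theta pen X n w) = +oo%E}.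
Proof.
pose inTh th := exists2 K, (0 < K)%N & Theta K th.
have dstar : has_pos_density mu Pstar pstar.
  by split=> // z; have [] := A3_star z.
have dth th : inTh th -> has_pos_density mu (P th) (p th).
  move=> hth; split; [|exact: p_meas|exact: p_dens].
  by move=> z; have [] := A3_th _ hth z.
have mln (q : Borel Z -> R) : measurable_fun [set: Borel Z] q ->
    measurable_fun [set: Borel Z] (fun z => ln (q z)).
  by move=> mq; apply: (measurableT_comp _ mq); exact: measurable_ln.
(* Two log-densities between [l] and [u] differ by at most [u - l], which later is also the envelope
   [G] of Wald's argument. *)
have intB (q r : Borel Z -> R) : measurable_fun [set: Borel Z] q ->
    measurable_fun [set: Borel Z] r ->
    (forall z, l z <= ln (q z) <= u z) -> (forall z, l z <= ln (r z) <= u z) ->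
    (forall z, `|ln (q z) - ln (r z)| <= u z - l z) /\
    Pstar.-integrable [set: Borel Z] (fun z => (ln (q z) - ln (r z))%:E).
  move=> mq mr hq hr.
  have qr z : `|ln (q z) - ln (r z)| <= u z - l z.
    move: (hq z) (hr z) => /andP[? ?] /andP[? ?].
    by rewrite ler_norml; apply/andP; split; lra.
  split=> //; apply: le_integrable A3_int => //.
    by apply/measurable_EFinP/measurable_funB; exact: mln.
  by move=> z _; rewrite lee_fin; apply: le_trans (qr z) (ler_norm _).
have star_bd z : l z <= ln (pstar z) <= u z by have [] := A3_star z.
have th_bd th z : inTh th -> l z <= ln (p th z) <= u z.
  by move=> hth; have [] := A3_th _ hth z.
have relE th : inTh th ->
    relent Pstar (P th) = (\int[Pstar]_z (ln (pstar z) - ln (p th z))%:E)%E.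
  by move=> hth; exact: relent_density dstar (dth _ hth).
have relfin th : inTh th -> relent Pstar (P th) \is a fin_num.
  move=> hth; rewrite relE//; apply: integrable_fin_num => //.
  by apply: (intB pstar (p th) _ (p_meas _ hth) _ _).2 => // z; exact: th_bd.
split.
  move=> [th hth PthE]; have [K K0 Kth] := hth.
  (* Positivity is given at [K.+1], and nesting puts [th] there. *)
  have [+ _] := H_gap _ K0; apply/negP; rewrite -leNgt.
  apply: (@le_trans _ _ (relent Pstar (P th))).
    by apply: ereal_inf_lbound; exists th => //; exact: Theta_nested.
  (* If the two laws coincide, [pstar] is a density of both, and the integrand vanishes. *)
  rewrite (_ : relent _ _ = 0)%E// (@relent_density _ _ _ mu _ _ pstar pstar) //.
    by rewrite integral0_eq// => z _; rewrite subrr.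
  by have [? ? dE] := dstar; split=> // A mA; rewrite PthE// dE.
(* [K] can be fixed, as countably many negligible sets unite to a negligible one. *)
suff critS K : (0 < K)%N -> {ae Pr, forall w, \forall n \near \oo,
    (crit (fun th z => ln (p th z)) Theta pen X n K w <
     crit (fun th z => ln (p th z)) Theta pen X n K.+1 w)%E}.
  have : {ae Pr, forall w, forall K, (0 < K)%N -> \forall n \near \oo,
    (crit (fun th z => ln (p th z)) Theta pen X n K w <
     crit (fun th z => ln (p th z)) Theta pen X n K.+1 w)%E}.
    apply: ae_foralln => K; have [->|K0] := posnP K; first exact: aeW.
    by have := critS _ K0; apply: filterS.
  by apply: filterS => w; exact: limn_einf_Khat.
move=> K0; have [_ /ereal_inf_lt[_ [th0 Th0 <-] H0]] := H_gap _ K0.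
have hth0 : inTh th0 by exists K.+1.
have hth th : Theta K th -> inTh th by exists K.
set I0 := relent Pstar (P th0) in H0.
have I0fin : I0 \is a fin_num := relfin _ hth0.
(* A real [r] is introduced because the infimum is [+oo] when [Theta K] is empty. *)
have [r I0r rH] : exists2 r : R, (I0 < r%:E)%E & (r%:E <= relent_set Pstar P (Theta K))%E.
  have := H0; rewrite -(fineK I0fin).
  case: (relent_set Pstar P (Theta K)) => [r||//] Ir; first by exists r.
  by exists (fine I0 + 1); rewrite ?leey// lte_fin ltrDl.
(* Half the gap: the means of the ratios below are at most [- 2 c], hence strictly below [- c]. *)
pose c := (r - fine I0) / 2.
have c0 : 0 < c.
  by rewrite divr_gt0// subr_gt0 -lte_fin fineK.
(* The drift [c n] is spent in two halves, one on the penalty and one on the random constant [C]. *)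
have c2 : 0 < c / 2 by exact: divr_gt0.
pose h th z := ln (p th z) - ln (p th0 z).
have hP th : Theta K th -> (forall z, `|h th z| <= u z - l z) /\
    Pstar.-integrable [set: Borel Z] (fun z => (h th z)%:E).
  move=> Kth; apply: (intB (p th) (p th0) (p_meas _ (hth _ Kth)) (p_meas _ hth0));
    by move=> z; apply: th_bd => //; exact: hth.
have hc th : Theta K th -> (\int[Pstar]_z (h th z)%:E < (- c)%:E)%E.
  move=> Kth.
  have i0 : Pstar.-integrable [set: Borel Z] (fun z => (ln (pstar z) - ln (p th0 z))%:E).
    by apply: (intB pstar (p th0) _ (p_meas _ hth0) _ _).2 => // z; exact: th_bd.
  have i1 : Pstar.-integrable [set: Borel Z] (fun z => (ln (pstar z) - ln (p th z))%:E).
    by apply: (intB pstar (p th) _ (p_meas _ (hth _ Kth)) _ _).2 => // z; apply: th_bd; exact: hth.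
  (* The mean of a log-likelihood ratio against [th0] is a difference of relative entropies, as the
     [ln (pstar z)] terms cancel. *)
  have -> : (\int[Pstar]_z (h th z)%:E = I0 - relent Pstar (P th))%E.
    rewrite /I0 !relE//; last exact: hth.
    rewrite -(integralB_EFin measurableT i0 i1); apply: eq_integral => z _.
    by rewrite -EFinB /h; congr EFin; lra.
  have Irel : (r%:E <= relent Pstar (P th))%E.
    by apply: (le_trans rH); apply: ereal_inf_lbound; exists th.
  move: Irel; rewrite -(fineK I0fin) -(fineK (relfin _ (hth _ Kth))).
  by rewrite -EFinB lee_fin lte_fin => ?; move: c0; rewrite /c; lra.
have ch (z : Borel Z) : {within Theta K, continuous (fun th => h th z)}.
  by move=> th; apply: cvgB; [exact: (A2 z _ K0)|exact: cvg_cst].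
have mh th : Theta K th -> measurable_fun [set: Borel Z] (h th).
  by move=> Kth; apply: measurable_funB; apply: mln; apply: p_meas => //; exact: hth.
have := wald (A1_Theta _ K0) mh (fun th z Kth => (hP th Kth).1 z) A3_int ch
  X_meas X_indep X_law hc.
apply: filterS => w [C CP]; near=> n.
have n0 : (0 < n)%N by near: n; exact: nbhs_infty_gt.
(* The likelihood at [th0] cancels, leaving [C - c n + pen n K.+1 < 0] to prove. *)
apply: (@crit_ltS _ _ _ _ _ _ _ _ n K w th0
  (\sum_(i < n) ln (p th0 (X i w)) + (C - c * n%:R))) => //.
- move=> th Kth; rewrite -lerBlDl -sumrB; exact: CP.
- by apply: ltW; exact: pen_gt0.
have nR : (0 : R) < n%:R by rewrite ltr0n.
have pn : pen n K.+1 <= c / 2 * n%:R.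
  rewrite -ler_pdivrMr//; apply: le_trans (ler_norm _) _; rewrite -normrN -sub0r.
  near: n; have /cvgrPdist_le/(_ _ c2) := pen_on K.+1 isT; exact.
have Cn : C < c / 2 * n%:R.
  rewrite mulrC -ltr_pdivrMr//.
  by near: n; exact: nbhs_infty_gtr.
by rewrite -addrA gtrDl; lra.
Unshelve. all: by end_near. Qed.
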